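(* For each $i=1,\dots,m$, let $\{\tilde x_{i,k}\}$ be generated by the parallel forward-backward splitting method described in the context (with parameter $\sigma\in\,]0,1[$), and let $\{\tilde x_{i,k}^a\}$, $\{u'_{i,k}\}$, $\{\varepsilon'_{i,k}\}$, $\{u'^{\,a}_{i,k}\}$, $\{\varepsilon'^{\,a}_{i,k}\}$ and $\{\varepsilon''^{\,a}_{i,k}\}$ be the associated sequences defined in the context. Let $d_{0,\Sigma}$ denote the distance of $(x_0+y_{1,0},\dots,x_0+y_{m,0})$ to the extended solution set $\mathcal S^*(\Sigma)$ (defined in the context) in which $T_i:=\nabla f_i+\partial\varphi_i$ for $i=1,\dots,m$, and define $L_\Sigma:=\max\{L_i\}_{i=1}^m$. The following hold: (a) For any $k\ge1$, there exists $j\in\{1,\dots,k\}$ such that $$u'_{i,j}\in\big(\partial_{\varepsilon'_{i,j}}f_i+\partial\varphi_i\big)(\tilde x_{i,j})\quad\forall i=1,\dots,m,$$ $$\Big\|\sum_{i=1}^mu'_{i,j}\Big\|\le\frac{\sqrt m\,L_\Sigma\,d_{0,\Sigma}}{\sigma^2\sqrt k}\sqrt{\frac{1+\sigma}{1-\sigma}},$$ $$\|\tilde x_{i,j}-\tilde x_{\ell,j}\|\le\frac{2\,d_{0,\Sigma}}{\sqrt k}\sqrt{\frac{1+\sigma}{1-\sigma}}\quad\forall i,\ell=1,\dots,m,$$ $$\sum_{i=1}^m\varepsilon'_{i,j}\le\frac{L_\Sigma\,d_{0,\Sigma}^2}{2(1-\sigma^2)k};$$ (b) for any $k\ge1$,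 $$u'^{\,a}_{i,k}\in\Big(\partial_{\varepsilon''^{\,a}_{i,k}}f_i+\partial_{(\varepsilon'^{\,a}_{i,k}-\varepsilon''^{\,a}_{i,k})}\varphi_i\Big)(\tilde x_{i,k}^a)\quad\forall i=1,\dots,m,$$ $$\Big\|\sum_{i=1}^mu'^{\,a}_{i,k}\Big\|\le\frac{2\sqrt m\,L_\Sigma\,d_{0,\Sigma}}{\sigma^2k},$$ $$\|\tilde x_{i,k}^a-\tilde x_{\ell,k}^a\|\le\frac{4\,d_{0,\Sigma}}{k}\quad\forall i,\ell=1,\dots,m,$$ $$\sum_{i=1}^m\varepsilon'^{\,a}_{i,k}\le\frac{2(1+\sigma/\sqrt{1-\sigma^2})\,L_\Sigma\,d_{0,\Sigma}^2}{\sigma^2k}.$$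
   Context: $\mathcal H$ is a real Hilbert space, $\overline{\mathbb R}=\mathbb R\cup\{\pm\infty\}$, $m\ge2$. The problem is $\min_{x\in\mathcal H}\sum_{i=1}^m(f_i+\varphi_i)(x)$ under these assumptions for all $i=1,\dots,m$: $f_i:\mathcal H\to\mathbb R$ is convex and differentiable with $\|\nabla f_i(x)-\nabla f_i(y)\|\le L_i\|x-y\|$ for all $x,y\in\mathcal H$, where $L_i>0$; $\varphi_i:\mathcal H\to\overline{\mathbb R}$ is proper, convex and closed, with an easily computable resolvent $(\lambda\partial\varphi_i+I)^{-1}$ for any $\lambda>0$; the solution set of the problem is nonempty; and the $\varphi_i$ satisfy standard regularity conditions making the minimization problem equivalent to finding $x$ with $0\in\sum_{i=1}^m(\nabla f_i+\partial\varphi_i)(x)$. Here $\partial_\varepsilon g(x)=\{v:\ g(y)\ge g(x)+\langle v,y-x\rangle-\varepsilon\ \forall y\}$ is the $\varepsilon$-subdifferential ($\varepsilon\ge0$) and $\partial g=\partial_0g$. $\mathcal H^m$ carries the inner product $\langle(x_i),(x_i')\rangle=\sum_{i=1}^m\langle x_i,x_i'\rangle$ and the induced norm. For maximal monotone $T_1,\dots,T_m$ on $\mathcal H$, the extended solution set of $0\in\sum_{i=1}^mT_i(x)$, assumed nonempty, is $$\mathcal S^*(\Sigma):=\Big\{(z_i)_{i=1}^m\in\mathcal H^m:\ \exists\,x,u_1,\dots,u_m\in\mathcal H,\ u_i\in T_i(x)\ \forall i,\ \sum_{i=1}^mu_i=0,\ z_i=x+u_i\ \forall i\Big\}.$$ Parallel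 forward-backward splitting method: given $(x_0,y_{1,0},\dots,y_{m,0})\in\mathcal H^{m+1}$ with $y_{1,0}+\dots+y_{m,0}=0$ and $\sigma\in\,]0,1[$, set $\lambda=\sigma^2/\max\{L_i\}_{i=1}^m$; for $k=1,2,\dots$ compute $$\tilde x_{i,k}=(\lambda\partial\varphi_i+I)^{-1}\big(x_{k-1}+y_{i,k-1}-\lambda\nabla f_i(x_{k-1})\big),\quad i=1,\dots,m,$$ and set $x_k=\frac1m\sum_{i=1}^m\tilde x_{i,k}$, $y_{i,k}=y_{i,k-1}+x_k-\tilde x_{i,k}$ for $i=1,\dots,m$. Associated quantities, for $k\ge1$ and $i=1,\dots,m$: $u_{i,k}:=x_{k-1}+y_{i,k-1}-\tilde x_{i,k}$; $\ \varepsilon_{i,k}:=\lambda\big[f_i(\tilde x_{i,k})-f_i(x_{k-1})-\langle\nabla f_i(x_{k-1}),\tilde x_{i,k}-x_{k-1}\rangle\big]$; $\tilde x_{i,k}^a:=\frac1k\sum_{\ell=1}^k\tilde x_{i,\ell}$; $\ u_{i,k}^a:=\frac1k\sum_{\ell=1}^ku_{i,\ell}$; $\ \varepsilon_{i,k}^a:=\frac1k\sum_{\ell=1}^k\big[\varepsilon_{i,\ell}+\langle\tilde x_{i,\ell}-\tilde x_{i,k}^a,u_{i,\ell}-u_{i,k}^a\rangle\big]$; $u'_{i,k}:=\frac1\lambda u_{i,k}$, $\ \varepsilon'_{i,k}:=\frac1\lambda\varepsilon_{i,k}$, $\ u'^{\,a}_{i,k}:=\frac1\lambda u_{i,k}^a$,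 $\ \varepsilon'^{\,a}_{i,k}:=\frac1\lambda\varepsilon_{i,k}^a$; $\varepsilon''^{\,a}_{i,k}:=\frac1k\sum_{\ell=1}^k\Big[\varepsilon'_{i,\ell}+\Big\langle\tilde x_{i,\ell}-\tilde x_{i,k}^a,\ \nabla f_i(x_{\ell-1})-\frac1k\sum_{s=1}^k\nabla f_i(x_{s-1})\Big\rangle\Big]$.
   Formalization: The distance d_{0,Σ} is taken to the extended solution set of the scaled operators λT_i = λ(∇f_i+∂φ_i) instead of T_i; with T_i the bounds fail, e.g. on the line with f_i=0, φ_1(x)=x, φ_2(x)=−x, λ=1/4, x_0=0, y_0=(1,−1). *)

(* Defs.v *)
From HB Require Import structures.
From mathcomp Require Import all_boot all_order all_algebra sesquilinear.
From mathcomp Require Import all_classical all_reals all_analysis.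

Set Implicit Arguments.
Unset Strict Implicit.
Unset Printing Implicit Defensive.

Import Order.TTheory GRing.Theory Num.Theory.
Import numFieldNormedType.Exports.

Local Open Scope classical_set_scope.
Local Open Scope ring_scope.

Section Operators.
Context {R : realType} {H : lmodType R}.
Implicit Types (S T : H -> set H) (lam : R).

(* Set-valued operators on H, with Minkowski sums of the values. *)
Definition op_add S T : H -> set H := fun x => [set a + b | a in S x & b in T x].

Definition op_scale lam T : H -> set H := fun x => [set lam *: v | v in T x].

Definition op_fun (g : H -> H) : H -> set H := fun x => [set g x].

Definition op_sum (m : nat) (T : 'I_m -> H -> set H) : H -> set H :=
  fun x => [set \sum_i u i | u in [set u : 'I_m -> H | forall i, T i x (u i)]].

(* resolvent lam T w is the value (lam T + I)^-1 (w) of the inverse operator;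
   for T maximal monotone and 0 < lam it is a singleton (Minty). *)
Definition resolvent lam T : H -> set H :=
  fun w => [set x | op_add (op_scale lam T) (op_fun id) x w].

(* For a splitting method with step size lam, the set to which the distance is
   measured is ext_sol_set (fun i => op_scale lam (T i)), with elements
   (x + lam u_i)_i. Unless lam = 1 the set for T itself is not the right one:
   with f_i = 0, phi_1 = id, phi_2 = -id on the line and lam = 1/4, the start
   x_0 = 0, (y_1, y_2) = (1, -1) lies in ext_sol_set T, but the first iterates
   3/4 and -3/4 are distinct. *)
Definition ext_sol_set (m : nat) (T : 'I_m -> H -> set H) : set ('I_m -> H) :=
  [set z | exists x (u : 'I_m -> H),
    [/\ forall i, T i x (u i), \sum_i u i = 0 & forall i, z i = x + u i]].

End Operators.

Section Convex.
Context {R : realType} {H : normedModType R}.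
Implicit Types (phi : H -> \bar R).

Definition proper_efun phi :=
  (exists x, (phi x < +oo)%E) /\ (forall x, (-oo < phi x)%E).

Definition convex_efun phi := forall (x y : H) (t : R), 0 < t < 1 ->
  (phi (t *: x + (1 - t) *: y)%R <= t%:E * phi x + (1 - t)%:E * phi y)%E.

Definition epigraph phi : set (H * R) := [set p | (phi p.1 <= (p.2)%:E)%E].

Definition closed_efun phi := closed (epigraph phi).

Definition minimizer (F : H -> \bar R) : set H :=
  [set x | forall y, (F x <= F y)%E].

End Convex.

Section Hilbert.
Context {R : realType} {H : normedModType R}.
Variable ip : {dot H for (@idfun R)}.

(* The eps-subdifferential; for proper phi, membership forces 0 <= eps and
   phi x finite. *)
Definition esubdiff (eps : R) (phi : H -> \bar R) : H -> set H :=
  fun x => [set v | forall y, (phi x + (ip v (y - x))%:E - eps%:E <= phi y)%E].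

Definition subdiff (phi : H -> \bar R) := esubdiff 0 phi.

Definition is_gradient (f : H -> R^o) (df : H -> H) := forall x,
  differentiable f x /\ forall h, 'd f x h = ip (df x) h.

(* H^m with its inner product; the library norm on products would be the sup
   norm. *)
Definition prod_ip (m : nat) (z w : 'I_m -> H) : R := \sum_i ip (z i) (w i).

Definition prod_norm (m : nat) (z : 'I_m -> H) : R := Num.sqrt (prod_ip z z).

Definition prod_dist (m : nat) (z : 'I_m -> H) (S : set ('I_m -> H)) : R :=
  inf [set prod_norm (fun i => z i - w i) | w in S].

End Hilbert.

Section Splitting.
Context {R : realType} {H : normedModType R}.
Variable ip : {dot H for (@idfun R)}.
Variables (m : nat) (f : 'I_m -> H -> R) (df : 'I_m -> H -> H).
Variables (phi : 'I_m -> H -> \bar R) (lam : R).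
Variables (x : nat -> H) (y xt : 'I_m -> nat -> H).

(* The values xt i 0 play no role. *)
Record parallel_fb : Prop := ParallelFB {
  pfb_init : \sum_i y i 0%N = 0;
  pfb_res : forall i k, resolvent lam (subdiff ip (phi i))
              (x k + y i k - lam *: df i (x k)) (xt i k.+1);
  pfb_x : forall k, x k.+1 = m%:R^-1 *: \sum_i xt i k.+1;
  pfb_y : forall i k, y i k.+1 = y i k + x k.+1 - xt i k.+1 }.

Definition avg (V : lmodType R) (a : nat -> V) (k : nat) : V :=
  k%:R^-1 *: \sum_(1 <= l < k.+1) a l.

(* The sequences below are meant for k >= 1. *)
Definition pfb_u i k : H := x k.-1 + y i k.-1 - xt i k.

Definition pfb_eps i k : R :=
  lam * (f i (xt i k) - f i (x k.-1) - ip (df i (x k.-1)) (xt i k - x k.-1)).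

Definition pfb_xa i : nat -> H := avg (xt i).

Definition pfb_ua i : nat -> H := avg (pfb_u i).

Definition pfb_epsa i k : R :=
  k%:R^-1 * \sum_(1 <= l < k.+1)
    (pfb_eps i l + ip (xt i l - pfb_xa i k) (pfb_u i l - pfb_ua i k)).

Definition pfb_u' i k : H := lam^-1 *: pfb_u i k.

Definition pfb_eps' i k : R := lam^-1 * pfb_eps i k.

Definition pfb_ua' i k : H := lam^-1 *: pfb_ua i k.

Definition pfb_epsa' i k : R := lam^-1 * pfb_epsa i k.

Definition pfb_epsa'' i k : R :=
  k%:R^-1 * \sum_(1 <= l < k.+1)
    (pfb_eps' i l + ip (xt i l - pfb_xa i k)
       (df i (x l.-1) - avg (fun s => df i (x s.-1)) k)).

End Splitting.

(* Main.v *)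
Require Import Defs.
From HB Require Import structures.
From mathcomp Require Import all_boot all_order all_algebra sesquilinear.
From mathcomp Require Import all_classical all_reals all_analysis.
From mathcomp Require Import ring lra.

Set Implicit Arguments.
Unset Strict Implicit.
Unset Printing Implicit Defensive.

Import Order.TTheory GRing.Theory Num.Theory.
Import numFieldNormedType.Exports.

Local Open Scope classical_set_scope.
Local Open Scope ring_scope.

(** Write z_l = (x_l + y_(i,l))_i for the state of the method in H^m and
    v_l = z_(l-1) - z_l for its steps. Let V be the diagonal of H^m; the y part
    lies in its orthogonal complement. Exchanging the V-components of the two
    members of a pair (xt_l, u_l) of elements of H^m gives the pair (v_l, z_l),
    and this exchange preserves the inner product of the two members
    ([spingarn_pairing]). Let s = p + w be an extended solution, with p in V and
    w in its complement. The exchange turns (xt_l - p, u_l - w) into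
    (v_l, z_l - s), so the almost-monotonicity <xt_l - p, u_l - w> >= - eps_l
    of the subdifferentials becomes <z_l - s, v_l> >= - eps_l
    ([step_dissipative]).

    The errors are small compared with the steps: the descent lemma and the
    choice lam = sigma^2 / L give 2 eps_l <= sigma^2 |v_l|^2 ([sum_eps_le]).
    Hence the method is an inexact proximal point method, and
      |z_l - s|^2 + (1 - sigma^2) |v_l|^2 <= |z_(l-1) - s|^2   ([fejer]).

    Pointwise rate: summing shows that the k first squared steps add up to at
    most d0^2 / (1 - sigma^2), so one of them is at most this bound divided by k.
    All residuals are read off from v_l, since the sum of the u_(i,l) is the sum
    of the v_(i,l), and xt_(i,l) - xt_(j,l) = v_(i,l) - v_(j,l).

    Ergodic rate: the steps telescope, so their mean is (z_0 - z_k) / k, and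
    |z_0 - z_k| <= 2 d0 because the state never moves away from a solution. For
    the errors, the exchange identity turns the covariance of xt and u into the
    one of z and v; there 2 <z_l - a, v_l> is a difference of squared distances
    to a minus |v_l|^2, which for the mean a of the states leaves
    |z_0 - a|^2 <= 4 d0^2. The inclusions for the means are the transportation
    formula for eps-subgradients ([esubdiff_avg]).

    Distances to the solution set enter only through squares: an estimate
    A <= |z_0 - s|^2 valid for all solutions s gives A <= d0^2. *)

(** * Real inner products *)

Section InnerProduct.
Context {R : realType} {H : normedModType R}.
Variable ip : {dot H for (@idfun R)}.
Implicit Types (a b c : H).

Lemma ipC a b : ip a b = ip b a.
Proof. by rewrite hermC expr0 mul1r. Qed.

Lemma ipDl a b c : ip (a + b) c = ip a c + ip b c.
Proof. exact: linearDl. Qed.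

Lemma ipNl a c : ip (- a) c = - ip a c.
Proof. exact: linearNl. Qed.

Lemma ipZl (t : R) a c : ip (t *: a) c = t * ip a c.
Proof. exact: (linearZl_LR ip c t a). Qed.

Lemma ipDr c a b : ip c (a + b) = ip c a + ip c b.
Proof. by rewrite !(ipC c) ipDl. Qed.

Lemma ipNr c a : ip c (- a) = - ip c a.
Proof. by rewrite !(ipC c) ipNl. Qed.

Lemma ipZr c (t : R) a : ip c (t *: a) = t * ip c a.
Proof. by rewrite !(ipC c) ipZl. Qed.

Lemma ip0l c : ip 0 c = 0.
Proof. exact: linear0l. Qed.

Definition ipE := (ipDl, ipDr, ipNl, ipNr, ipZl, ipZr).

Lemma ip_suml I (s : seq I) (P : pred I) (a : I -> H) c :
  ip (\sum_(i <- s | P i) a i) c = \sum_(i <- s | P i) ip (a i) c.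
Proof. exact: (linear_sumlz ip). Qed.

Lemma ip_sumr I (s : seq I) (P : pred I) c (a : I -> H) :
  ip c (\sum_(i <- s | P i) a i) = \sum_(i <- s | P i) ip c (a i).
Proof. by rewrite ipC ip_suml; apply: eq_bigr => i _; rewrite ipC. Qed.

Lemma ip_ge0 a : 0 <= ip a a.
Proof.
have [->|a0] := eqVneq a 0; first by rewrite ip0l.
exact/ltW/neq0_dnorm_gt0.
Qed.

(** The mean of the a_i is the point with the least sum of squared distances to
    them; this sum is nonnegative. *)
Lemma ip_sqr_sum_le n (a : 'I_n -> H) :
  ip (\sum_i a i) (\sum_i a i) <= n%:R * \sum_i ip (a i) (a i).
Proof.
case: n a => [|n] a; first by rewrite !big_ord0 ip0l mul0r.
(* Expand the sum of the squared distances to the mean S / N. *)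
set N : R := n.+1%:R; have N0 : 0 < N by rewrite ltr0n.
set S := \sum_i a i.
have : 0 <= \sum_i ip (a i - N^-1 *: S) (a i - N^-1 *: S).
  by apply: sumr_ge0 => i _; exact: ip_ge0.
have -> : \sum_i ip (a i - N^-1 *: S) (a i - N^-1 *: S) =
          \sum_i ip (a i) (a i) - N^-1 * ip S S.
  transitivity (\sum_i (ip (a i) (a i) - 2 * N^-1 * ip (a i) S
                        + N^-1 ^+ 2 * ip S S)).
    by apply: eq_bigr => i _; rewrite !ipE (ipC S (a i)); ring.
  rewrite big_split sumrB /= sumr_const card_ord -mulr_sumr -ip_suml -/S.
  rewrite -mulr_natl -/N; field; exact: lt0r_neq0.
by rewrite subr_ge0 mulrC ler_pdivrMr// mulrC.
Qed.

Lemma ip_cauchy_schwarz a b : ip a b ^+ 2 <= ip a a * ip b b.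
Proof.
have [->|b0] := eqVneq b 0; first by rewrite (ipC a) !ip0l mulr0 expr0n.
have B0 : 0 < ip b b by exact: neq0_dnorm_gt0.
(* This vector is <b, b> times the component of a orthogonal to b. *)
have := ip_ge0 (ip b b *: a - ip a b *: b).
rewrite (_ : ip _ _ = ip b b * (ip a a * ip b b - ip a b ^+ 2)); last first.
  by rewrite !ipE (ipC b a); ring.
by rewrite pmulr_rge0// subr_ge0.
Qed.

End InnerProduct.

(** * Arithmetic means of sequences *)

Section Averages.
Context {R : realType}.

Lemma avgE (V : lmodType R) (a : nat -> V) k : (0 < k)%N ->
  \sum_(1 <= l < k.+1) a l = k%:R *: avg a k.
Proof. by move=> k0; rewrite scalerA divff ?scale1r// pnatr_eq0 -lt0n. Qed.

Lemma avg_telescope (V : lmodType R) (a : nat -> V) k :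
  avg (fun l => a l.-1 - a l) k = k%:R^-1 *: (a 0%N - a k).
Proof.
rewrite /avg big_add1 /=; congr (_ *: _).
by under eq_bigr do rewrite -opprB; rewrite sumrN telescope_sumr// opprB.
Qed.

Lemma eq_avg (V : lmodType R) (a b : nat -> V) k :
  (forall l, (0 < l)%N -> a l = b l) -> avg a k = avg b k.
Proof.
by move=> ab; congr (_ *: _); apply: eq_big_nat => l /andP[l0 _]; exact: ab.
Qed.

Lemma avgD (V : lmodType R) (a b : nat -> V) k :
  avg (fun l => a l + b l) k = avg a k + avg b k.
Proof. by rewrite /avg big_split scalerDr. Qed.

Lemma avgZ (V : lmodType R) (t : R) (a : nat -> V) k :
  avg (fun l => t *: a l) k = t *: avg a k.
Proof. by rewrite /avg -scaler_sumr !scalerA mulrC. Qed.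

Lemma avgB (V : lmodType R) (a b : nat -> V) k :
  avg (fun l => a l - b l) k = avg a k - avg b k.
Proof. by rewrite /avg sumrB scalerBr. Qed.

Lemma avg_cst (V : lmodType R) (c : V) k : (0 < k)%N -> avg (fun=> c) k = c.
Proof.
move=> k0; rewrite /avg sumr_const_nat subn1 /= -[c *+ _]scaler_nat scalerA.
by rewrite mulVf ?scale1r// pnatr_eq0 -lt0n.
Qed.

Lemma avg_sum (V : lmodType R) n (a : 'I_n -> nat -> V) k :
  avg (fun l => \sum_i a i l) k = \sum_i avg (a i) k.
Proof. by rewrite /avg exchange_big scaler_sumr. Qed.

Lemma exists_le_mean (a : nat -> R) k : (0 < k)%N ->
  exists2 j, (1 <= j <= k)%N & k%:R * a j <= \sum_(1 <= l < k.+1) a l.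
Proof.
case: k => // k _; elim: k => [|k [j /andP[j1 jk] IH]].
  by exists 1%N; rewrite // big_nat1 mul1r.
have kS b : k.+2%:R * b = k.+1%:R * b + b :> R by rewrite -natr1 mulrDl mul1r.
rewrite big_nat_recr//=; have [aj|aj] := leP (a j) (a k.+2).
  by exists j; [rewrite j1 leqW|rewrite kS lerD].
exists k.+2; rewrite ?leqnn// kS lerD2r.
by rewrite (le_trans _ IH)// ler_wpM2l// ltW.
Qed.

Context {H : normedModType R}.
Variable ip : {dot H for (@idfun R)}.

Lemma sum_covariance (a b : nat -> H) k : (0 < k)%N ->
  \sum_(1 <= l < k.+1) ip (a l - avg a k) (b l - avg b k) =
  \sum_(1 <= l < k.+1) ip (a l) (b l) - k%:R * ip (avg a k) (avg b k).
Proof.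
move=> k0.
move: (avg a k) (avg b k) (avgE a k0) (avgE b k0) => A B sumA sumB.
transitivity (\sum_(1 <= l < k.+1) (ip (a l) (b l) - ip (a l) B
    - ip A (b l) + ip A B)).
  by apply: eq_bigr => l _; rewrite !ipE; ring.
rewrite big_split /= !sumrB sumr_const_nat subn1 /= -mulr_natl.
by rewrite -(ip_suml _ _ _ a) -(ip_sumr _ _ _ _ b) sumA sumB ipZl ipZr; ring.
Qed.

Lemma ip_avg_le (a : nat -> H) k : (0 < k)%N ->
  k%:R * ip (avg a k) (avg a k) <= \sum_(1 <= l < k.+1) ip (a l) (a l).
Proof.
move=> k0; rewrite -subr_ge0 -sum_covariance//.
by apply: sumr_ge0 => l _; exact: ip_ge0.
Qed.

End Averages.

(** * Subgradients with errors *)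

Section Subdifferentials.
Context {R : realType} {H : normedModType R}.
Variable ip : {dot H for (@idfun R)}.
Implicit Types (phi : H -> \bar R) (f : H -> R) (df : H -> H).

(** An affine minorant that is exact up to e at a bounds phi a by the value of
    phi at a point of its domain. *)
Lemma esubdiff_fin phi e a v : proper_efun phi -> esubdiff ip e phi a v ->
  phi a \is a fin_num.
Proof.
move=> [[b fb] gtNy] /(_ b) h.
apply: fin_real; rewrite gtNy /= ltNge leye_eq; apply/negP => /eqP ay.
by move: (le_lt_trans h fb); rewrite ay.
Qed.

(** Add the subgradient inequality at a, tested at b, to the one at b, tested
    at a. *)
Lemma esubdiff_monotone phi e e' a b v w : proper_efun phi ->
  esubdiff ip e phi a v -> esubdiff ip e' phi b w ->
  - (e + e') <= ip (a - b) (v - w).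
Proof.
move=> pphi av bw.
have := bw a; have := av b.
rewrite -(fineK (esubdiff_fin pphi av)) -(fineK (esubdiff_fin pphi bw)).
rewrite -!EFinN -!EFinD !lee_fin !ipE (ipC ip v) (ipC ip v) (ipC ip w) (ipC ip w).
lra.
Qed.

(** Jensen's inequality for uniform weights, with real majorants of the values
    so that the mean is taken in the reals. *)
Lemma convex_efun_avg phi (a : nat -> H) (r : nat -> R) k : convex_efun phi ->
  (0 < k)%N -> (forall l, (1 <= l <= k)%N -> (phi (a l) <= (r l)%:E)%E) ->
  (phi (avg a k) <= (k%:R^-1 * \sum_(1 <= l < k.+1) r l)%:E)%E.
Proof.
move=> cphi; case: k => // k _; elim: k => [|k IH] hr.
  by rewrite /avg !big_nat1 invr1 scale1r mul1r; exact: hr.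
set n : R := k.+1%:R; have n0 : 0 < n by rewrite ltr0n.
have nE : k.+2%:R = n + 1 :> R by rewrite /n -[in LHS]addn1 natrD.
set t := n / (n + 1); have n10 : n + 1 != 0 by rewrite gt_eqF// addr_gt0.
have tE : 1 - t = (n + 1)^-1 by rewrite /t; field.
have tnE : t * n^-1 = (n + 1)^-1.
  by rewrite /t mulrAC divff ?mul1r// gt_eqF.
have t01 : 0 < t < 1.
  by rewrite /t divr_gt0 ?addr_gt0//= ltr_pdivrMr ?addr_gt0// mul1r ltrDl.
have -> : avg a k.+2 = t *: avg a k.+1 + (1 - t) *: a k.+2.
  rewrite tE /avg nE big_nat_recr//= scalerDr scalerA; congr (_ *: _ + _).
  by rewrite -/n tnE.
apply: (le_trans (cphi _ _ _ t01)).
have -> : k.+2%:R^-1 * (\sum_(1 <= l < k.+3) r l) =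
    t * (k.+1%:R^-1 * \sum_(1 <= l < k.+2) r l) + (1 - t) * r k.+2.
  by rewrite tE big_nat_recr//= nE -/n mulrDr mulrA tnE.
have /andP[t0 t1] := t01.
rewrite (EFinD (t * _)) (EFinM t) (EFinM (1 - t)); apply: leeD.
  apply: lee_wpmul2l; first by rewrite lee_fin ltW.
  by apply: IH => l /andP[l1 lk]; apply: hr; rewrite l1 leqW.
apply: lee_wpmul2l; first by rewrite lee_fin subr_ge0 ltW.
by apply: hr; rewrite leqnn.
Qed.

(** The transportation formula: the mean of the affine minorants given by the
    subgradients v_l is an affine minorant of phi, with slope the mean of the
    v_l. Its defect at the mean point is, by Jensen's inequality, at most the
    mean error plus the covariance of the a_l and the v_l. *)
Lemma esubdiff_avg phi (a v : nat -> H) (e : nat -> R) k :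
  proper_efun phi -> convex_efun phi -> (0 < k)%N ->
  (forall l, (1 <= l <= k)%N -> esubdiff ip (e l) phi (a l) (v l)) ->
  esubdiff ip (k%:R^-1 * \sum_(1 <= l < k.+1)
                 (e l + ip (a l - avg a k) (v l - avg v k)))
           phi (avg a k) (avg v k).
Proof.
move=> pphi cphi k0 he b.
have k0' : 0 < k%:R :> R by rewrite ltr0n.
have hfin l : (1 <= l <= k)%N -> phi (a l) = (fine (phi (a l)))%:E.
  by move=> /he /(esubdiff_fin pphi) /fineK.
have Ja := convex_efun_avg cphi k0 (r := fun l => fine (phi (a l)))
  (fun l hl => eq_ind_r (fun u => (u <= _)%E) (lexx _) (hfin l hl)).
apply: (le_trans (leeD2r _ (leeD2r _ Ja))).
case hb : (phi b) => [s| |]; last 2 first.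
- by rewrite leey.
- by have := pphi.2 b; rewrite hb.
rewrite -!EFinN -!EFinD lee_fin big_split /= sum_covariance// -(ler_pM2l k0').
have hs : \sum_(1 <= l < k.+1) (fine (phi (a l)) + ip (v l) (b - a l) - e l) <=
    k%:R * s.
  have -> : k%:R * s = \sum_(1 <= l < k.+1) s.
    by rewrite sumr_const_nat subn1 /= mulr_natl.
  rewrite big_nat [leRHS]big_nat; apply: ler_sum => l hl.
  by have := he l hl b; rewrite hb hfin// -EFinN -!EFinD lee_fin.
apply: le_trans hs; rewrite le_eqVlt; apply/orP; left; apply/eqP.
rewrite sumrB big_split /=.
move: (avg a k) (avg v k) (avgE v k0) => A V sumV.
have -> : \sum_(1 <= l < k.+1) ip (v l) (b - a l) =
    k%:R * ip V b - \sum_(1 <= l < k.+1) ip (a l) (v l).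
  rewrite -ipZl -sumV ip_suml -sumrB.
  by apply: eq_bigr => l _; rewrite !ipE (ipC ip (a l)).
by rewrite !ipE (ipC ip V A); field; rewrite gt_eqF.
Qed.

Lemma convex_function_efun f : convex_function [set: H] f ->
  convex_efun (EFin \o f).
Proof.
move=> cf a b t /andP[t0 t1] /=.
have t01 : 0 <= t <= 1 by rewrite !ltW.
have := cf (Itv01 (ltW t0) (ltW t1)) a b (mem_setT _) (mem_setT _).
by rewrite lee_fin.
Qed.

(** By convexity the difference quotients of f from a towards b are at most
    f b - f a; so is their limit, the directional derivative. *)
Lemma gradient_le f df a b : convex_efun (EFin \o f) -> is_gradient ip f df ->
  f a + ip (df a) (b - a) <= f b.
Proof.
move=> cf gf; have [df_a dfE] := gf a.
rewrite -dfE -deriveE// addrC -lerBrDr.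
have cv := @diff_derivable _ _ _ _ a (b - a) df_a.
have cvr := cvg_dnbhs_at_right cv.
rewrite /derive -(cvg_lim _ cvr)//.
apply: limr_le; first exact: cvgP cvr.
near=> t.
have t01 : 0 < t < 1.
  by apply/andP; split; near: t; [exact: nbhs_right_gt|exact: nbhs_right_lt].
have /andP[t0 t1] := t01.
rewrite /= -[_ *: _]/(_ * _) mulrC ler_pdivrMr//.
have -> : t *: (b - a) + a = t *: b + (1 - t) *: a.
  by rewrite scalerBr scalerBl scale1r addrAC addrA.
have := cf b a t t01; rewrite /= lee_fin; lra.
Unshelve. all: by end_near.
Qed.

End Subdifferentials.

(** * The descent lemma *)

Section Descent.
Context {R : realType} {H : normedModType R}.
Variable ip : {dot H for (@idfun R)}.
Context (ip_norm : forall v : H, `|v| = Num.sqrt (ip v v)).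

Lemma sqr_norm_ip (a : H) : `|a| ^+ 2 = ip a a.
Proof. by rewrite ip_norm sqr_sqrtr// ip_ge0. Qed.

Lemma ip_le_norm (a b : H) : ip a b <= `|a| * `|b|.
Proof.
apply: (le_trans (ler_norm _)).
rewrite -ler_sqr ?nnegrE ?mulr_ge0// exprMn !sqr_norm_ip real_normK ?num_real//.
exact: ip_cauchy_schwarz.
Qed.

(** The quadratic upper bound for a function with Lipschitz gradient. Instead of
    integrating the gradient, cut the segment from a to b into n equal pieces:
    convexity bounds the increase of f on each piece by the slope at its far
    end, which on the j-th piece exceeds the slope at a by at most
    C |b - a|^2 j / n. The pieces add up to the claim with an excess
    C |b - a|^2 / (2 n), which vanishes as n grows. *)
Lemma descent (f : H -> R) (df : H -> H) (C : R) (a b : H) :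
  convex_efun (EFin \o f) -> is_gradient ip f df ->
  (forall p q, `|df p - df q| <= C * `|p - q|) ->
  f b <= f a + ip (df a) (b - a) + C / 2 * `|b - a| ^+ 2.
Proof.
move=> cf gf lip; set h := b - a; set Q := `|h| ^+ 2; set G := ip (df a) h.
have partition n j :
    f (a + (j%:R / n.+1%:R) *: h) <=
    f a + j%:R / n.+1%:R * G + C * Q * (j%:R * (j%:R + 1)) / (2 * n.+1%:R ^+ 2).
  set N : R := n.+1%:R; have N0 : 0 < N by rewrite ltr0n.
  elim: j => [|j IH]; first by rewrite !mul0r scale0r mulr0 mul0r !addr0.
  set J : R := j%:R in IH *; set J1 : R := j.+1%:R.
  have J1E : J1 = J + 1 by rewrite /J1 -addn1 natrD.
  have J10 : 0 < J1 / N by rewrite divr_gt0// ltr0n.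
  set p := a + (J / N) *: h in IH *; set q := a + (J1 / N) *: h.
  have pq : p - q = - (N^-1 *: h).
    rewrite /p /q opprD addrACA subrr add0r -scalerBl J1E.
    by rewrite (_ : _ - _ = - N^-1) ?scaleNr//; field; rewrite gt_eqF.
  have := gradient_le q p cf gf; rewrite pq ipNr ipZr.
  have : ip (df q - df a) h <= C * (J1 / N) * Q.
    apply: (le_trans (ip_le_norm _ _)).
    rewrite /Q expr2 (mulrA (C * (J1 / N))) ler_wpM2r// (le_trans (lip _ _))//.
    by rewrite /q (addrC a) addrK normrZ gtr0_norm// (mulrA C (J1 / N)).
  rewrite ipDl ipNl -/G -(ler_pM2l (x := N^-1)) ?invr_gt0// => dq.
  move=> fq.
  have -> : f a + J1 / N * G + C * Q * (J1 * (J1 + 1)) / (2 * N ^+ 2) =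
      f a + J / N * G + C * Q * (J * (J + 1)) / (2 * N ^+ 2)
      + (N^-1 * G + N^-1 * (C * (J1 / N) * Q)).
    by rewrite J1E; field; rewrite gt_eqF.
  move: IH dq fq; rewrite mulrBr; set X := _ + _ / _; set Y := N^-1 * (C * _ * _).
  set Z := N^-1 * ip _ _; set W := N^-1 * G => *; lra.
apply/ler_addgt0Pr => e e0.
have [n hn] : exists n, C * Q / (2 * n.+1%:R) <= e.
  exists (Num.bound (C * Q / (2 * e))).
  have := archi_boundP; set n := Num.bound _ => _.
  have ne : C * Q / (2 * e) <= n.+1%:R.
    have [c0|c0] := leP 0 (C * Q / (2 * e)).
      by rewrite (le_trans (ltW (archi_boundP c0)))// ler_nat.
    by rewrite (le_trans (ltW c0)).
  have e2 : 0 < 2 * e by rewrite mulr_gt0.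
  rewrite ler_pdivrMr ?mulr_gt0 ?ltr0n//.
  by move: ne; rewrite ler_pdivrMr//; lra.
have n0 : n.+1%:R != 0 :> R by rewrite pnatr_eq0.
have := partition n n.+1; rewrite divff// scale1r mul1r.
rewrite (addrC a) subrK.
have -> : C * Q * (n.+1%:R * (n.+1%:R + 1)) / (2 * n.+1%:R ^+ 2) =
  C / 2 * Q + C * Q / (2 * n.+1%:R) by field; rewrite -natr1 in n0.
by move=> /le_trans; apply; rewrite addrA lerD2l.
Qed.

End Descent.

(** * The product space *)

Section ProductSpace.
Context {R : realType} {H : normedModType R}.
Variable ip : {dot H for (@idfun R)}.
Context (ip_norm : forall v : H, `|v| = Num.sqrt (ip v v)).
Variable m : nat.
Implicit Types (z w : 'I_m -> H).

Lemma prod_ip_ge0 w : 0 <= prod_ip ip w w.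
Proof. by apply: sumr_ge0 => i _; exact: ip_ge0. Qed.

Lemma prod_dist_ge0 z (S : set ('I_m -> H)) : 0 <= prod_dist ip z S.
Proof.
have [->|/set0P[w Sw]] := eqVneq S set0.
  by rewrite /prod_dist image_set0 inf0.
by apply: lb_le_inf => [|_ [? _ <-]]; [by apply: image_nonempty; exists w|exact: sqrtr_ge0].
Qed.

(** Taking square roots turns A into a lower bound of the norms whose infimum is
    the distance. *)
Lemma le_sqr_prod_dist z (S : set ('I_m -> H)) (A : R) : S !=set0 ->
  (forall w, S w -> A <= prod_ip ip (fun i => z i - w i) (fun i => z i - w i)) ->
  A <= prod_dist ip z S ^+ 2.
Proof.
move=> S0 hA.
have [A0|A0] := leP 0 A; last by rewrite (le_trans (ltW A0))// sqr_ge0.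
rewrite -(sqr_sqrtr A0) ler_sqr ?nnegrE ?prod_dist_ge0 ?sqrtr_ge0//.
apply: lb_le_inf => [|_ [w Sw <-]]; first by exact/image_nonempty/S0.
by rewrite /prod_norm ler_wsqrtr// hA.
Qed.

Lemma prod_ip_component_le w i : ip (w i) (w i) <= prod_ip ip w w.
Proof. by rewrite /prod_ip (bigD1 i)//= lerDl sumr_ge0// => j _; exact: ip_ge0. Qed.

Lemma norm_sum_le w : `|\sum_i w i| <= Num.sqrt m%:R * prod_norm ip w.
Proof.
by rewrite ip_norm -sqrtrM ?ler0n// ler_wsqrtr// ip_sqr_sum_le.
Qed.

Lemma norm_sub_le w i j : `|w i - w j| <= 2 * prod_norm ip w.
Proof.
have h l : `|w l| <= prod_norm ip w.
  by rewrite ip_norm ler_wsqrtr// prod_ip_component_le.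
by rewrite (le_trans (ler_normB _ _))// mulr_natl mulr2n lerD.
Qed.

(** The first argument of the inner product on the left is b with its diagonal
    component replaced by the one of a, and the second is a with the one of b.
    As the diagonal and its complement are orthogonal, both sides are the sum of
    the inner product of the diagonal components of a and b and of that of their
    complementary components. *)
Lemma spingarn_pairing (a b : 'I_m -> H) (abar bbar : H) :
  \sum_i a i = m%:R *: abar -> \sum_i b i = m%:R *: bbar ->
  prod_ip ip (fun i => abar + (b i - bbar)) (fun i => a i - abar + bbar) =
  prod_ip ip a b.
Proof.
move=> sa sb.
transitivity (\sum_i (ip (a i) (b i) + ip (a i) (abar - bbar)
   + ip (b i) (bbar - abar) - ip (abar - bbar) (abar - bbar))).
  apply: eq_bigr => i _; rewrite !ipE (ipC ip abar (a i)) (ipC ip bbar (a i)).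
  by rewrite (ipC ip (b i) (a i)) (ipC ip (b i) abar) (ipC ip bbar abar); ring.
rewrite sumrB !big_split /= -(ip_suml _ _ _ a) -(ip_suml _ _ _ b) sa sb.
rewrite sumr_const card_ord -mulr_natl !ipE (ipC ip bbar abar).
by rewrite /prod_ip; ring.
Qed.

(** A vector orthogonal to the diagonal has the same distance to the diagonal
    vectors b and - b. *)
Lemma prod_ip_reflection (a : 'I_m -> H) (b : H) : \sum_i a i = 0 ->
  prod_ip ip (fun i => a i + b) (fun i => a i + b) =
  prod_ip ip (fun i => a i - b) (fun i => a i - b).
Proof.
move=> sa; apply/eqP; rewrite -subr_eq0 -sumrB.
under eq_bigr => i _.
  rewrite (_ : _ - _ = ip (a i) (4 *: b)); last first.
    by rewrite !ipE (ipC ip b (a i)); ring.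
  over.
by rewrite -ip_suml sa ip0l.
Qed.

Lemma polarization (a b c : 'I_m -> H) :
  2 * prod_ip ip (fun i => b i - c i) (fun i => a i - b i) =
  prod_ip ip (fun i => a i - c i) (fun i => a i - c i)
  - prod_ip ip (fun i => b i - c i) (fun i => b i - c i)
  - prod_ip ip (fun i => a i - b i) (fun i => a i - b i).
Proof.
rewrite /prod_ip mulr_sumr -!sumrB; apply: eq_bigr => i _.
by rewrite !ipE (ipC ip (b i) (a i)) (ipC ip (c i) (a i)) (ipC ip (c i) (b i)); ring.
Qed.

Lemma prod_ip_sub_le (a b c : 'I_m -> H) :
  prod_ip ip (fun i => a i - b i) (fun i => a i - b i) <=
  2 * prod_ip ip (fun i => a i - c i) (fun i => a i - c i)
  + 2 * prod_ip ip (fun i => b i - c i) (fun i => b i - c i).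
Proof.
rewrite /prod_ip !mulr_sumr -!big_split /=; apply: ler_sum => i _.
have := ip_ge0 ip ((a i - c i) + (b i - c i)).
rewrite !ipE (ipC ip (b i) (a i)) (ipC ip (c i) (a i)) (ipC ip (c i) (b i)); lra.
Qed.

End ProductSpace.

(** * The steps of the parallel forward-backward method *)

Section ParallelForwardBackward.
Context {R : realType} {H : normedModType R}.
Variable ip : {dot H for (@idfun R)}.
Context (ip_norm : forall v : H, `|v| = Num.sqrt (ip v v)).
Context (m : nat) (f : 'I_m -> H -> R) (df : 'I_m -> H -> H).
Context (phi : 'I_m -> H -> \bar R) (LS sigma lam : R).
Context (x : nat -> H) (y xt : 'I_m -> nat -> H).
Context (m_gt0 : (0 < m)%N) (lam_gt0 : 0 < lam) (lamLS : lam * LS = sigma ^+ 2).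
Context (f_convex : forall i, convex_efun (EFin \o f i)).
Context (f_grad : forall i, is_gradient ip (f i) (df i)).
Context (df_lip : forall i a b, `|df i a - df i b| <= LS * `|a - b|).
Context (phi_proper : forall i, proper_efun (phi i)).
Context (phi_convex : forall i, convex_efun (phi i)).
Context (iter : parallel_fb ip df phi lam x y xt).

Local Notation S := (ext_sol_set
  (fun i => op_scale lam (op_add (op_fun (df i)) (subdiff ip (phi i))))).
Local Notation u := (pfb_u x y xt).
Local Notation eps := (pfb_eps ip f df lam x xt).
Local Notation eps' := (pfb_eps' ip f df lam x xt).
Local Notation u' := (pfb_u' lam x y xt).

Definition fb_state (l : nat) (i : 'I_m) : H := x l + y i l.

Definition fb_step (l : nat) (i : 'I_m) : H := fb_state l.-1 i - fb_state l i.

Local Notation z := fb_state.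
Local Notation v := fb_step.
Local Notation sqn w := (prod_ip ip w w).

Lemma proper_f i : proper_efun (EFin \o f i).
Proof. by split=> [|a]; [exists 0; exact: ltry|exact: ltNyr]. Qed.

Lemma sum_xt l : \sum_i xt i l.+1 = m%:R *: x l.+1.
Proof. by rewrite (pfb_x iter) scalerA divff ?scale1r// pnatr_eq0 -lt0n. Qed.

Lemma sumr_const_ord (c : H) : \sum_(i < m) c = m%:R *: c.
Proof. by rewrite sumr_const card_ord scaler_nat. Qed.

Lemma sum_y l : \sum_i y i l = 0.
Proof.
elim: l => [|l IH]; first exact: (pfb_init iter).
under eq_bigr do rewrite (pfb_y iter).
by rewrite sumrB big_split /= IH add0r sumr_const_ord sum_xt subrr.
Qed.

Lemma sum_u l : \sum_i u i l.+1 = m%:R *: (x l - x l.+1).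
Proof.
by rewrite /pfb_u sumrB big_split /= sum_y addr0 sumr_const_ord sum_xt scalerBr.
Qed.

(** The splitting of a step into its components off and on the diagonal: the
    spread of the xt_i, and the move of their mean. *)
Lemma fb_stepE l i : v l.+1 i = (xt i l.+1 - x l.+1) + (x l - x l.+1).
Proof.
rewrite /v /z (pfb_y iter) /= !opprD !opprK addrACA addrC.
by rewrite !addrA subrr sub0r (addrC (- _)).
Qed.

Lemma fb_stateE l i : z l.+1 i = x l.+1 + (u i l.+1 - (x l - x l.+1)).
Proof.
rewrite /z /pfb_u (pfb_y iter) /=; congr (_ + _).
by rewrite opprB -(addrA (x l)) [RHS]addrC addrA subrK addrCA addrA.
Qed.

Lemma sum_u_step l : (0 < l)%N -> \sum_i u i l = \sum_i v l i.
Proof.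
case: l => // l _; rewrite sum_u; under [RHS]eq_bigr do rewrite fb_stepE.
by rewrite big_split /= sumrB !sumr_const_ord sum_xt subrr add0r.
Qed.

Lemma xt_sub_step l i j : (0 < l)%N -> xt i l - xt j l = v l i - v l j.
Proof.
by case: l => // l _; rewrite !fb_stepE opprD addrACA subrr addr0 opprB addrA subrK.
Qed.

(** The descent lemma bounds the error by lam L / 2 times the squared distance
    of xt to the diagonal point x_(l-1), and this distance is the length of the
    step. *)
Lemma sum_eps_le l : (0 < l)%N -> 2 * \sum_i eps i l <= sigma ^+ 2 * sqn (v l).
Proof.
case: l => // l _.
have -> : sqn (v l.+1) = \sum_i `|xt i l.+1 - x l| ^+ 2.
  transitivity (sqn (fun i => (xt i l.+1 - x l.+1) - (x l - x l.+1))).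
    rewrite -prod_ip_reflection; last by rewrite sumrB sum_xt sumr_const_ord subrr.
    by rewrite /prod_ip; apply: eq_bigr => i _; rewrite fb_stepE.
  rewrite /prod_ip; apply: eq_bigr => i _; rewrite (sqr_norm_ip ip_norm).
  by rewrite opprB addrA subrK.
rewrite !mulr_sumr; apply: ler_sum => i _.
have := descent ip_norm (x l) (xt i l.+1) (f_convex i) (f_grad i) (df_lip i).
move/(ler_wpM2l (ltW lam_gt0)); rewrite -lamLS /pfb_eps /=; lra.
Qed.

(** The gradient at the old point is a subgradient at xt, with the linearization
    error as defect. *)
Lemma subdiff_f l i :
  esubdiff ip (eps' i l) (EFin \o f i) (xt i l) (df i (x l.-1)).
Proof.
move=> b /=; rewrite lee_fin /pfb_eps' /pfb_eps.
have := gradient_le (x l.-1) b (f_convex i) (f_grad i).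
rewrite mulrA mulVf ?gt_eqF// mul1r !ipE; lra.
Qed.

(** The optimality condition of the resolvent. *)
Lemma subdiff_phi l i : (0 < l)%N ->
  subdiff ip (phi i) (xt i l) (u' i l - df i (x l.-1)).
Proof.
case: l => // l _.
have [_ [q hq <-]] := pfb_res iter i l.
case=> _ -> /= e; rewrite /pfb_u' /pfb_u /=.
suff -> : lam^-1 *: (x l + y i l - xt i l.+1) - df i (x l) = q by [].
have -> : x l + y i l - xt i l.+1 = lam *: q + lam *: df i (x l).
  by apply/eqP; rewrite subr_eq addrAC -subr_eq e.
by rewrite scalerDr !scalerA mulVf ?gt_eqF// !scale1r addrK.
Qed.

(** Inexact monotonicity, carried over from the pairs (xt, u) to the pairs
    (z, v) by the exchange of diagonal components. *)
Lemma step_dissipative l w : (0 < l)%N -> S w ->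
  - \sum_i eps i l <= prod_ip ip (fun i => z l i - w i) (v l).
Proof.
move=> l0 [xs [ws [Tws sum_ws wE]]].
have -> : prod_ip ip (fun i => z l i - w i) (v l) =
    prod_ip ip (fun i => xt i l - xs) (fun i => u i l - ws i).
  case: l l0 => // l _.
  rewrite -(@spingarn_pairing _ _ ip _ (fun i => xt i l.+1 - xs)
    (fun i => u i l.+1 - ws i) (x l.+1 - xs) (x l - x l.+1)).
  - apply: eq_bigr => i _; congr (ip _ _).
      rewrite fb_stateE wE [- (xs + _)]opprD addrACA; congr (_ + _).
      exact: addrAC.
    by rewrite fb_stepE; congr (_ + _); rewrite opprB addrA subrK.
  - by rewrite sumrB sum_xt sumr_const_ord scalerBr.
  - by rewrite sumrB sum_ws subr0 sum_u.
rewrite -sumrN; apply: ler_sum => i _.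
have [_ [_ -> [q hq <-]] <-] := Tws i.
have hf := esubdiff_monotone (proper_f i) (subdiff_f l i)
  (_ : esubdiff ip 0 (EFin \o f i) xs (df i xs)).
have hp := esubdiff_monotone (phi_proper i) (subdiff_phi i l0) hq.
have {hf} : - (eps' i l + 0) <= ip (xt i l - xs) (df i (x l.-1) - df i xs).
  apply: hf => b /=; rewrite lee_fin subr0.
  exact: gradient_le.
rewrite !addr0 in hp *; move=> hf.
have uE : u i l = lam *: u' i l by rewrite scalerA divff ?gt_eqF// scale1r.
have epsE : eps i l = lam * eps' i l by rewrite mulrA divff ?gt_eqF// mul1r.
have := ler_wpM2l (ltW lam_gt0) (lerD hf hp).
rewrite oppr0 addr0 mulrN -epsE -ipDr -ipZr => /le_trans; apply.
rewrite uE -scalerBr le_eqVlt; apply/orP; left.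
by apply/eqP; congr (ip _ (_ *: _)); rewrite addrACA -opprD (addrC (df _ _)) subrK.
Qed.

(** The three-point identity for z_(l-1), z_l and w, where the inner product is
    bounded by the dissipativity; the errors consume only the fraction sigma^2
    of the squared step. *)
Lemma fejer l w : (0 < l)%N -> S w ->
  sqn (fun i => z l i - w i) + (1 - sigma ^+ 2) * sqn (v l) <=
  sqn (fun i => z l.-1 i - w i).
Proof.
move=> l0 Sw.
have := step_dissipative l0 Sw; have := sum_eps_le l0.
have := polarization ip (z l.-1) (z l) w; rewrite -/(v l).
lra.
Qed.

Lemma fejer_sum k w : S w ->
  sqn (fun i => z k i - w i) + (1 - sigma ^+ 2) * \sum_(1 <= l < k.+1) sqn (v l)
  <= sqn (fun i => z 0 i - w i).
Proof.
move=> Sw; elim: k => [|k IH]; first by rewrite big_nil mulr0 addr0.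
rewrite big_nat_recr//= mulrDr; have := fejer (ltn0Sn k) Sw.
move: IH; rewrite /=; lra.
Qed.

(** * Convergence rates *)

Context (sigma01 : 0 < sigma < 1) (S0 : S !=set0).

Local Notation d0 := (prod_dist ip (z 0) S).
Local Notation ua' := (pfb_ua' lam x y xt).
Local Notation xa := (pfb_xa xt).
Local Notation epsa' := (pfb_epsa' ip f df lam x y xt).
Local Notation epsa'' := (pfb_epsa'' ip f df lam x xt).

Lemma onem_sqr_gt0 : 0 < 1 - sigma ^+ 2.
Proof. by have /andP[s0 s1] := sigma01; rewrite subr_gt0 expr_lt1// ltW. Qed.

Lemma sum_sqn_step_le k :
  (1 - sigma ^+ 2) * \sum_(1 <= l < k.+1) sqn (v l) <= d0 ^+ 2.
Proof.
apply: le_sqr_prod_dist => // w Sw; apply: le_trans (fejer_sum k Sw).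
by rewrite lerDr prod_ip_ge0.
Qed.

Lemma state_nonexpansive k w : S w ->
  sqn (fun i => z k i - w i) <= sqn (fun i => z 0 i - w i).
Proof.
move=> Sw; apply: le_trans (fejer_sum k Sw); rewrite lerDl.
by rewrite mulr_ge0 ?(ltW onem_sqr_gt0)// sumr_ge0// => l _; exact: prod_ip_ge0.
Qed.

(** The parallelogram inequality bounds the left side by 4 |z_0 - w|^2 for every
    solution w, and the infimum over w may be taken. *)
Lemma sqn_sub_state0_le (a : 'I_m -> H) :
  (forall w, S w -> sqn (fun i => a i - w i) <= sqn (fun i => z 0 i - w i)) ->
  sqn (fun i => z 0 i - a i) <= 4 * d0 ^+ 2.
Proof.
move=> ha; rewrite mulrC -ler_pdivrMr//; apply: le_sqr_prod_dist => // w Sw.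
rewrite ler_pdivrMr//; have := prod_ip_sub_le ip (z 0) a w; have := ha w Sw.
lra.
Qed.

(** By convexity of the squared distance, the mean of the states is as close to
    every solution as the initial state is. *)
Lemma sqn_avg_state_le k : (0 < k)%N ->
  sqn (fun i => z 0 i - avg (fun l => z l i) k) <= 4 * d0 ^+ 2.
Proof.
move=> k0; apply: sqn_sub_state0_le => w Sw.
have kR : 0 < k%:R :> R by rewrite ltr0n.
rewrite -(ler_pM2l kR) {1}/prod_ip mulr_sumr.
apply: (@le_trans _ _ (\sum_(1 <= l < k.+1) sqn (fun i => z l i - w i))).
  rewrite exchange_big; apply: ler_sum => i _.
  by rewrite -{1 2}(avg_cst (w i) k0) -avgB ip_avg_le.
have -> : k%:R * sqn (fun i => z 0 i - w i) =
    \sum_(1 <= l < k.+1) sqn (fun i => z 0 i - w i).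
  by rewrite sumr_const_nat subn1 /= mulr_natl.
by apply: ler_sum => l _; exact: state_nonexpansive.
Qed.

Lemma avg_step k i : avg (fun l => v l i) k = k%:R^-1 *: (z 0 i - z k i).
Proof. exact: (avg_telescope (fun l => z l i)). Qed.

Lemma norm_avg_step_le k : (0 < k)%N ->
  prod_norm ip (fun i => avg (fun l => v l i) k) <= 2 * d0 / k%:R.
Proof.
move=> k0; have kR : 0 < k%:R :> R by rewrite ltr0n.
have dk0 : 0 <= 2 * d0 / k%:R.
  by rewrite divr_ge0 ?mulr_ge0 ?prod_dist_ge0// ltW.
rewrite -[leRHS](ger0_norm dk0) -sqrtr_sqr ler_wsqrtr//.
have -> : (2 * d0 / k%:R) ^+ 2 = k%:R^-1 ^+ 2 * (4 * d0 ^+ 2).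
  by field; rewrite gt_eqF.
have -> : sqn (fun i => avg (fun l => v l i) k) =
    k%:R^-1 ^+ 2 * sqn (fun i => z 0 i - z k i).
  rewrite /prod_ip mulr_sumr; apply: eq_bigr => i _.
  by rewrite avg_step ipZl ipZr expr2 mulrA.
rewrite ler_pM2l ?exprn_gt0 ?invr_gt0//.
by apply: sqn_sub_state0_le => w; exact: state_nonexpansive.
Qed.

(** The sum over l of the errors and covariances is computed in the variables z
    and v; the telescoping sum of the three-point identities, with the mean of
    the states as third point, absorbs the errors into the squared steps. *)
Lemma sum_epsa_le k : (0 < k)%N ->
  \sum_i pfb_epsa ip f df lam x y xt i k <= 2 * d0 ^+ 2 / k%:R.
Proof.
move=> k0; have kR : 0 < k%:R :> R by rewrite ltr0n.
rewrite /pfb_epsa -mulr_sumr mulrC ler_pM2r ?invr_gt0//.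
rewrite exchange_big /=.
under eq_bigr do rewrite big_split /=.
rewrite big_split /=.
(* The exchange identity is applied to the deviations from the means. *)
pose za i := avg (fun l => z l i) k.
have -> : \sum_(1 <= l < k.+1) \sum_i
     ip (xt i l - pfb_xa xt i k) (u i l - pfb_ua x y xt i k) =
   \sum_(1 <= l < k.+1) prod_ip ip (fun i => z l i - za i) (v l).
  transitivity (\sum_(1 <= l < k.+1)
     prod_ip ip (fun i => z l i - za i) (fun i => v l i - avg (fun l => v l i) k)).
    apply: eq_big_nat => -[//|l] _.
    pose X := avg x k; pose D := avg (fun l => x l.-1 - x l) k.
    rewrite -[LHS](@spingarn_pairing _ _ ip _ (fun i => xt i l.+1 - pfb_xa xt i k)
      (fun i => u i l.+1 - pfb_ua x y xt i k) (x l.+1 - X) (x l - x l.+1 - D)).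
    - apply: eq_bigr => i _; congr (ip _ _).
        have -> : za i = X + (pfb_ua x y xt i k - D).
          rewrite -avgB -avgD; apply: eq_avg => -[//|j] _; exact: fb_stateE.
        rewrite fb_stateE [- (X + _)]opprD [RHS]addrACA; congr (_ + _).
        by rewrite [- (_ - D)]opprD addrACA -opprD.
      have -> : avg (fun l => v l i) k = pfb_xa xt i k - X + D.
        rewrite -avgB -avgD; apply: eq_avg => -[//|j] _; exact: fb_stepE.
      rewrite fb_stepE [- (pfb_xa xt i k - X + D)]opprD [RHS]addrACA; congr (_ + _).
      by rewrite [- (_ - X)]opprD addrACA -opprD.
    - have sumXa : \sum_i pfb_xa xt i k = m%:R *: X.
        by rewrite -avgZ -avg_sum; apply: eq_avg => -[//|j] _; exact: sum_xt.
      by rewrite sumrB sum_xt sumXa scalerBr.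
    - have sumUa : \sum_i pfb_ua x y xt i k = m%:R *: D.
        by rewrite -avgZ -avg_sum; apply: eq_avg => -[//|j] _; exact: sum_u.
      by rewrite sumrB sum_u sumUa -scalerBr.
  (* Deviations sum to zero, so the mean of the steps drops out. *)
  rewrite /prod_ip exchange_big [RHS]exchange_big; apply: eq_bigr => i _ /=.
  transitivity (\sum_(1 <= l < k.+1) (ip (z l i - za i) (v l i) -
     ip (z l i - za i) (avg (fun l => v l i) k))).
    by apply: eq_bigr => l _; rewrite ipDr ipNr.
  rewrite sumrB -ip_suml sumrB (avgE (fun l => z l i))// sumr_const_nat subn1 /=.
  by rewrite -[za i *+ k]scaler_nat subrr ip0l subr0.
have h n : \sum_(1 <= l < n.+1) \sum_i eps i l +
    \sum_(1 <= l < n.+1) prod_ip ip (fun i => z l i - za i) (v l) <=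
    (sqn (fun i => z 0 i - za i) - sqn (fun i => z n i - za i)) / 2.
  elim: n => [|n IH]; first by rewrite !big_nil addr0 subrr mul0r.
  rewrite !(big_nat_recr n.+1)//=.
  have := polarization ip (z n) (z n.+1) za; rewrite -/(v n.+1).
  have := sum_eps_le (ltn0Sn n); have := prod_ip_ge0 ip (v n.+1).
  have := mulr_ge0 (ltW onem_sqr_gt0) (prod_ip_ge0 ip (v n.+1)).
  move: IH; lra.
apply: (le_trans (h k)); rewrite ler_pdivrMr//.
have := sqn_avg_state_le k0; have := prod_ip_ge0 ip (fun i => z k i - za i).
rewrite -/za; lra.
Qed.

Lemma pointwise_rate k : (1 <= k)%N -> exists j : nat,
    [/\ (1 <= j <= k)%N,
        forall i, op_add (esubdiff ip (eps' i j) (EFin \o f i))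
                         (subdiff ip (phi i)) (xt i j) (u' i j),
        `|\sum_i u' i j| <= Num.sqrt m%:R * LS * d0 / (sigma ^+ 2 * Num.sqrt k%:R)
                            * Num.sqrt ((1 + sigma) / (1 - sigma)),
        forall i l, `|xt i j - xt l j| <= 2 * d0 / Num.sqrt k%:R
                            * Num.sqrt ((1 + sigma) / (1 - sigma)) &
        \sum_i eps' i j <= LS * d0 ^+ 2 / (2 * (1 - sigma ^+ 2) * k%:R)].
Proof.
move=> k0; have [j jk vj] := exists_le_mean (fun l => sqn (v l)) k0.
have j0 : (0 < j)%N by case/andP: jk.
have kR : 0 < k%:R :> R by rewrite ltr0n.
have /andP[s0 s1] := sigma01; have os := onem_sqr_gt0.
have s_neq0 : sigma != 0 by rewrite gt_eqF.
have LSE : LS = sigma ^+ 2 / lam by rewrite -lamLS mulrAC divff ?mul1r// gt_eqF.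
have lam0 : lam != 0 by rewrite gt_eqF.
have vd : sqn (v j) <= d0 ^+ 2 / ((1 - sigma ^+ 2) * k%:R).
  rewrite ler_pdivlMr ?mulr_gt0// mulrC -mulrA.
  apply: le_trans (sum_sqn_step_le k); rewrite ler_pM2l//.
(* (1 - sigma^2)^-1 <= (1 + sigma) / (1 - sigma), as 1 <= (1 + sigma)^2. *)
set r := Num.sqrt ((1 + sigma) / (1 - sigma)).
have Vd : prod_norm ip (v j) <= d0 / Num.sqrt k%:R * r.
  have -> : d0 / Num.sqrt k%:R * r =
      Num.sqrt (d0 ^+ 2 / k%:R * ((1 + sigma) / (1 - sigma))).
    rewrite sqrtrM ?divr_ge0 ?sqr_ge0 ?(ltW kR)// sqrtrM ?sqr_ge0//.
    by rewrite sqrtr_sqr ger0_norm ?prod_dist_ge0// sqrtrV// ltW.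
  rewrite ler_wsqrtr// (le_trans vd)// [_ * k%:R]mulrC invfM (mulrA (d0 ^+ 2)).
  apply: ler_wpM2l.
    by rewrite divr_ge0 ?sqr_ge0// ltW.
  have s1' : 0 < 1 - sigma by rewrite subr_gt0.
  have -> : 1 - sigma ^+ 2 = (1 - sigma) * (1 + sigma) by ring.
  have s1p : 1 <= 1 + sigma by rewrite lerDl ltW.
  rewrite invfM mulrC ler_pM2r ?invr_gt0//.
  by rewrite (le_trans _ s1p)// invf_le1// (lt_le_trans _ s1p).
exists j; split => //.
- move=> i; exists (df i (x j.-1)); first exact: subdiff_f.
  by exists (u' i j - df i (x j.-1)); [exact: subdiff_phi|rewrite addrC subrK].
- rewrite -scaler_sumr sum_u_step// normrZ gtr0_norm ?invr_gt0//.
  have -> : Num.sqrt m%:R * LS * d0 / (sigma ^+ 2 * Num.sqrt k%:R) * r =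
      lam^-1 * (Num.sqrt m%:R * (d0 / Num.sqrt k%:R * r)).
    by rewrite LSE; field; rewrite lam0 s_neq0 gt_eqF ?sqrtr_gt0.
  rewrite ler_pM2l ?invr_gt0// (le_trans (norm_sum_le ip_norm _))//.
  by rewrite ler_wpM2l ?sqrtr_ge0.
- move=> i l; rewrite xt_sub_step// (le_trans (norm_sub_le ip_norm _ _ _))//.
  by rewrite -!mulrA ler_pM2l// mulrA.
rewrite -mulr_sumr mulrC ler_pdivrMr//.
have -> : LS * d0 ^+ 2 / (2 * (1 - sigma ^+ 2) * k%:R) * lam =
    sigma ^+ 2 / 2 * (d0 ^+ 2 / ((1 - sigma ^+ 2) * k%:R)).
  by rewrite LSE; field; rewrite lam0 (gt_eqF os) (gt_eqF kR).
have := sum_eps_le j0; have := ler_wpM2l (sqr_ge0 sigma) vd; lra.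
Qed.

Lemma ergodic_rate k : (1 <= k)%N ->
    [/\ forall i, op_add (esubdiff ip (epsa'' i k) (EFin \o f i))
                         (esubdiff ip (epsa' i k - epsa'' i k) (phi i))
                         (xa i k) (ua' i k),
        `|\sum_i ua' i k| <= 2 * Num.sqrt m%:R * LS * d0 / (sigma ^+ 2 * k%:R),
        forall i l, `|xa i k - xa l k| <= 4 * d0 / k%:R &
        \sum_i epsa' i k <= 2 * (1 + sigma / Num.sqrt (1 - sigma ^+ 2)) * LS * d0 ^+ 2
                            / (sigma ^+ 2 * k%:R)].
Proof.
move=> k0.
have kR : 0 < k%:R :> R by rewrite ltr0n.
have /andP[s0 s1] := sigma01; have os := onem_sqr_gt0.
have s_neq0 : sigma != 0 by rewrite gt_eqF.
have LSE : LS = sigma ^+ 2 / lam by rewrite -lamLS mulrAC divff ?mul1r// gt_eqF.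
have lam0 : lam != 0 by rewrite gt_eqF.
have V := norm_avg_step_le k0.
split.
- move=> i; set g := fun l => df i (x l.-1).
  have uaE : ua' i k = avg (u' i) k by rewrite /pfb_ua' -avgZ.
  exists (avg g k).
    apply: esubdiff_avg => //; first exact: proper_f.
    by move=> l _; exact: subdiff_f.
  exists (ua' i k - avg g k); last by rewrite addrC subrK.
  rewrite uaE -avgB.
  have -> : epsa' i k - epsa'' i k = k%:R^-1 * \sum_(1 <= l < k.+1)
      (0 + ip (xt i l - avg (xt i) k) (u' i l - g l - avg (fun l => u' i l - g l) k)).
    rewrite /pfb_epsa' /pfb_epsa /pfb_epsa'' mulrCA -mulrBr.
    rewrite mulr_sumr -sumrB; congr (_ * _); apply: eq_bigr => l _.
    rewrite avgB -uaE /pfb_u' /pfb_ua' /pfb_eps' -/g -/(xa i k) -/(g l).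
    move: (xa i k) (avg g k) (pfb_ua _ _ _ _ _) => A G U.
    by rewrite !ipE; ring.
  apply: esubdiff_avg => // l /andP[l0 _]; exact: subdiff_phi.
- have -> : \sum_i ua' i k = lam^-1 *: \sum_i avg (fun l => v l i) k.
    rewrite /pfb_ua' -scaler_sumr -!avg_sum; congr (_ *: _).
    by apply: eq_avg => l; exact: sum_u_step.
  rewrite normrZ gtr0_norm ?invr_gt0//.
  have -> : 2 * Num.sqrt m%:R * LS * d0 / (sigma ^+ 2 * k%:R) =
      lam^-1 * (Num.sqrt m%:R * (2 * d0 / k%:R)).
    by rewrite LSE; field; rewrite lam0 s_neq0 (gt_eqF kR).
  rewrite ler_pM2l ?invr_gt0// (le_trans (norm_sum_le ip_norm _))//.
  by rewrite ler_wpM2l ?sqrtr_ge0.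
- move=> i l.
  have -> : xa i k - xa l k = avg (fun n => v n i) k - avg (fun n => v n l) k.
    by rewrite -!avgB; apply: eq_avg => n; exact: xt_sub_step.
  rewrite (le_trans (norm_sub_le ip_norm (fun i => avg (fun l => v l i) k) _ _))//.
  have -> : 4 * d0 / k%:R = 2 * (2 * d0 / k%:R) by field; rewrite gt_eqF.
  by rewrite ler_pM2l.
rewrite /pfb_epsa' -mulr_sumr mulrC ler_pdivrMr//.
apply: (le_trans (sum_epsa_le k0)).
have -> : 2 * (1 + sigma / Num.sqrt (1 - sigma ^+ 2)) * LS * d0 ^+ 2 /
    (sigma ^+ 2 * k%:R) * lam =
    (1 + sigma / Num.sqrt (1 - sigma ^+ 2)) * (2 * d0 ^+ 2 / k%:R).
  by rewrite LSE; field; rewrite lam0 s_neq0 (gt_eqF kR) gt_eqF ?sqrtr_gt0.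
rewrite -[leLHS]mul1r ler_wpM2r//.
  by apply: divr_ge0; [rewrite mulr_ge0 ?sqr_ge0|exact: ltW].
by rewrite lerDl divr_ge0 ?sqrtr_ge0// ltW.
Qed.

End ParallelForwardBackward.

Theorem theorem4p4 (R : realType) (H : completeNormedModType R)
  (ip : {dot H for (@idfun R)})
  (ip_norm : forall v : H, `|v| = Num.sqrt (ip v v))
  (m : nat) (m_ge2 : (2 <= m)%N)
  (f : 'I_m -> H -> R) (df : 'I_m -> H -> H) (L : 'I_m -> R)
  (phi : 'I_m -> H -> \bar R)
  (L_gt0 : forall i, 0 < L i)
  (f_convex : forall i, convex_function [set: H] (f i))
  (f_grad : forall i, is_gradient ip (f i) (df i))
  (df_lip : forall i a b, `|df i a - df i b| <= L i * `|a - b|)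
  (phi_proper : forall i, proper_efun (phi i))
  (phi_convex : forall i, convex_efun (phi i))
  (phi_closed : forall i, closed_efun (phi i))
  (T := fun i => op_add (op_fun (df i)) (subdiff ip (phi i)))
  (F := fun a => (\sum_i ((f i a)%:E + phi i a))%E)
  (sol_nonempty : minimizer F !=set0)
  (regular : forall a, minimizer F a <-> op_sum T a 0)
  (sigma : R) (sigma01 : 0 < sigma < 1)
  (LS := \big[Num.max/0]_i L i)
  (lam := sigma ^+ 2 / LS)
  (x : nat -> H) (y xt : 'I_m -> nat -> H)
  (iter : parallel_fb ip df phi lam x y xt)
  (xa := pfb_xa xt)
  (u' := pfb_u' lam x y xt)
  (eps' := pfb_eps' ip f df lam x xt)
  (ua' := pfb_ua' lam x y xt)
  (epsa' := pfb_epsa' ip f df lam x y xt)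
  (epsa'' := pfb_epsa'' ip f df lam x xt)
  (d0 := prod_dist ip (fun i => x 0%N + y i 0%N)
           (ext_sol_set (fun i => op_scale lam (T i)))) :
  (forall k : nat, (1 <= k)%N -> exists j : nat,
    [/\ (1 <= j <= k)%N,
        forall i, op_add (esubdiff ip (eps' i j) (EFin \o f i))
                         (subdiff ip (phi i)) (xt i j) (u' i j),
        `|\sum_i u' i j| <= Num.sqrt m%:R * LS * d0 / (sigma ^+ 2 * Num.sqrt k%:R)
                            * Num.sqrt ((1 + sigma) / (1 - sigma)),
        forall i l, `|xt i j - xt l j| <= 2 * d0 / Num.sqrt k%:R
                            * Num.sqrt ((1 + sigma) / (1 - sigma)) &
        \sum_i eps' i j <= LS * d0 ^+ 2 / (2 * (1 - sigma ^+ 2) * k%:R)]) /\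
  (forall k : nat, (1 <= k)%N ->
    [/\ forall i, op_add (esubdiff ip (epsa'' i k) (EFin \o f i))
                         (esubdiff ip (epsa' i k - epsa'' i k) (phi i))
                         (xa i k) (ua' i k),
        `|\sum_i ua' i k| <= 2 * Num.sqrt m%:R * LS * d0 / (sigma ^+ 2 * k%:R),
        forall i l, `|xa i k - xa l k| <= 4 * d0 / k%:R &
        \sum_i epsa' i k <= 2 * (1 + sigma / Num.sqrt (1 - sigma ^+ 2)) * LS * d0 ^+ 2
                            / (sigma ^+ 2 * k%:R)]).
Proof.
have m0 : (0 < m)%N by exact: ltnW.
have LS_ge i : L i <= LS by apply: le_bigmax.
have LS_gt0 : 0 < LS := lt_le_trans (L_gt0 (Ordinal m0)) (LS_ge _).
have /andP[s0 _] := sigma01.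
have lam0 : 0 < lam by rewrite divr_gt0// exprn_gt0.
have lamLS : lam * LS = sigma ^+ 2 by rewrite divfK// gt_eqF.
have f_cvx i := convex_function_efun (f_convex i).
have lip i a b : `|df i a - df i b| <= LS * `|a - b|.
  by rewrite (le_trans (df_lip i a b))// ler_wpM2r.
have sol0 : ext_sol_set (fun i => op_scale lam (T i)) !=set0.
  have [a /regular [w Tw w0]] := sol_nonempty.
  exists (fun i => a + lam *: w i), a, (fun i => lam *: w i); split => //.
    by move=> i; exists (w i).
  by rewrite -scaler_sumr w0 scaler0.
split=> k k1.
  exact: (pointwise_rate ip_norm m0 lam0 lamLS).
exact: (ergodic_rate ip_norm m0 lam0 lamLS).
Qed.
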